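(* Let $(G,l,c,B)$ be an instance of (2-SPNI) where $G$ is a two-terminal series-parallel graph with source $s$ and sink $t$, and let $T_G$ be a decomposition tree of $G$. Define, for every graph $H$ in $T_G$ and every $x\in\{0,1,\dots,B\}$, a set $\mathcal{L}(H,x)\subseteq(\mathbb{N}\cup\{\infty\})^2$ bottom-up as follows. If $H$ is a leaf with single arc $a^*$: if $c(a^* )\leq B$ then $\mathcal{L}(H,x)=\{(l^1(a^* ),l^2(a^* ))\}$ for $x=0,\dots,c(a^* )-1$ and $\mathcal{L}(H,x)=\{(\infty,\infty)\}$ for $x=c(a^* ),\dots,B$; if $c(a^* )>B$ then $\mathcal{L}(H,x)=\{(l^1(a^* ),l^2(a^* ))\}$ for all $x$. If $H$ is the parallel composition of $H_1$ and $H_2$, then $\mathcal{L}(H,x)=\max\left\{\bigcup_{k=0}^{x}\mathcal{L}(H_1,k)\odot\mathcal{L}(H_2,x-k)\right\}$. If $H$ is the series composition of $H_1$ and $H_2$, then $\mathcal{L}(H,x)=\max\left\{\bigcup_{k=0}^{x}\mathcal{L}(H_1,k)\oplus\mathcal{L}(H_2,x-k)\right\}$. Then $\mathcal{L}(G,B)$ is the set $Z_N$ of non-dominated points of the instance $(G,l,c,B)$.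
   Context: (2-SPNI) instance $(G,l,c,B)$: directed network $G=(V,A)$ (parallel arcs allowed) with source $s$, sink $t$, lengths $l=(l^1,l^2):A\to\mathbb{N}^2$, costs $c:A\to\mathbb{N}$, budget $B\in\mathbb{N}$. Feasible strategies $\Gamma=\{\gamma\in\{0,1\}^A:\sum_a c(a)\gamma_a\leq B\}$; $G(\gamma)$ is $G$ with arcs $a$ having $\gamma_a=1$ removed; $f_G(\gamma)=(f^1_G(\gamma),f^2_G(\gamma))$ with $f^i_G(\gamma)$ the minimum $l^i$-length of an $s$-$t$-path in $G(\gamma)$ ($\infty$ if none). Pareto order: $y_1\geq y_2$ iff $y_1^k\geq y_2^k$ for $k=1,2$ and $y_1\neq y_2$ (with $\infty$ larger than every integer). $\gamma\in\Gamma$ is efficient if no $\gamma'\in\Gamma$ has $f_G(\gamma')\geq f_G(\gamma)$; $Z_N$ is the set of $f_G(\gamma)$ for efficient $\gamma$. Two-terminal series-parallel graphs are built from single-arc graphs $(s,t)$ by parallel composition (identify the two sources and the two sinks) and series composition (identify the sink of the first with the source of the second; the new source is the first's source, the new sink the second's sink). A decomposition tree $T_G$ is a rooted binary tree whose nodes are graphs: the root is $G$, leaves are single-arc (primitive) subgraphs corresponding to the arcs of $G$, and each internal node is the parallel or series composition of its two children (with the same lengths and costs restricted to its arcs). For sets $S,T$: $S\oplus T=\{a+b:a\in S,b\in T\}$ (with $\infty+z=\infty$), $S\odot T=\{(\min\{a^1,b^1\},\min\{a^2,b^2\}):a\in S,b\in T\}$, and $\max\{S\}$ is the set of elements of $S$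 not dominated (in the Pareto order) by another element of $S$. *)

(* Defs.v *)
From mathcomp Require Import all_boot.
From mathcomp Require Import classical_sets.

Set Implicit Arguments.
Unset Strict Implicit.
Unset Printing Implicit Defensive.

(* MathComp; sets of points are the Prop-valued sets of mathcomp-classical. *)

(* N extended with infinity, which is represented by None. *)
Definition enat := option nat.

Definition ele (x y : enat) : bool :=
  match x, y with
  | _, None => true
  | None, Some _ => false
  | Some m, Some n => m <= n
  end.

Definition emin (x y : enat) : enat :=
  match x, y with
  | None, _ => y
  | _, None => x
  | Some m, Some n => Some (minn m n)
  end.

Definition eadd (x y : enat) : enat :=
  match x, y with
  | Some m, Some n => Some (m + n)
  | _, _ => None
  end.

Definition epoint := (enat * enat)%type.

Definition dominates (y1 y2 : epoint) : bool :=
  [&& ele y2.1 y1.1, ele y2.2 y1.2 & y1 != y2].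

Local Open Scope classical_set_scope.

Definition oplus (S T : set epoint) : set epoint :=
  [set (eadd a.1 b.1, eadd a.2 b.2) | a in S & b in T].

Definition odot (S T : set epoint) : set epoint :=
  [set (emin a.1 b.1, emin a.2 b.2) | a in S & b in T].

Definition pareto_max (S : set epoint) : set epoint :=
  [set y | S y /\ forall y', S y' -> ~~ dominates y' y].

Local Close Scope classical_set_scope.

(* Arcs form a type of their own, hence parallel arcs are allowed. *)
Record network := Network {
  vertex : finType;
  edge : finType;
  tail : edge -> vertex;
  head : edge -> vertex;
  source : vertex;
  sink : vertex }.

(* A two-terminal subgraph of G, given by its vertices, arcs and terminals. That
   the terminals and the endpoints of the arcs are among the vertices is not
   recorded: it holds for G, for G with arcs removed, and, by induction, for
   every node of a decomposition tree. *)
Record subnet (G : network) := Subnet {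
  vset : {set vertex G};
  eset : {set edge G};
  src : vertex G;
  snk : vertex G }.

Definition whole (G : network) : subnet G :=
  Subnet [set: vertex G]%SET [set: edge G]%SET (source G) (sink G).

Definition arc_subnet (G : network) (a : edge G) : subnet G :=
  Subnet [set tail a; head a]%SET [set a]%SET (tail a) (head a).

(* H is obtained from H1 and H2 by identifying terminals. Both being subgraphs
   of one network, this means that they share exactly the identified vertices
   and no arc. *)
Record is_parallel (G : network) (H H1 H2 : subnet G) : Prop := IsParallel {
  par_src : src H1 = src H2;
  par_snk : snk H1 = snk H2;
  par_shared : vset H1 :&: vset H2 = [set src H1; snk H1]%SET;
  par_disjoint : [disjoint eset H1 & eset H2];
  par_vset : vset H = vset H1 :|: vset H2;
  par_eset : eset H = eset H1 :|: eset H2;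
  par_source : src H = src H1;
  par_sink : snk H = snk H1 }.

Record is_series (G : network) (H H1 H2 : subnet G) : Prop := IsSeries {
  ser_middle : snk H1 = src H2;
  ser_shared : vset H1 :&: vset H2 = [set snk H1]%SET;
  ser_disjoint : [disjoint eset H1 & eset H2];
  ser_vset : vset H = vset H1 :|: vset H2;
  ser_eset : eset H = eset H1 :|: eset H2;
  ser_source : src H = src H1;
  ser_sink : snk H = snk H2 }.

(* The decomposition trees with root H. The two terminals of a single-arc graph
   are distinct vertices, so loops are excluded. G is two-terminal
   series-parallel exactly when [decomp_tree (whole G)] is inhabited. *)
Inductive decomp_tree (G : network) : subnet G -> Type :=
| Leaf (a : edge G) of tail a != head a : decomp_tree (arc_subnet a)
| Par (H H1 H2 : subnet G) of is_parallel H H1 H2 &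
    decomp_tree H1 & decomp_tree H2 : decomp_tree H
| Ser (H H1 H2 : subnet G) of is_series H H1 H2 &
    decomp_tree H1 & decomp_tree H2 : decomp_tree H.

Section Interdiction.

Variable G : network.

Fixpoint walk (x : vertex G) (p : seq (edge G)) (y : vertex G) : bool :=
  if p is a :: p' then (tail a == x) && walk (head a) p' y else x == y.

(* A path, given by its sequence of arcs, repeats no vertex. *)
Definition is_path (H : subnet G) (p : seq (edge G)) : bool :=
  [&& all [in eset H] p, walk (src H) p (snk H)
    & uniq (src H :: [seq head a | a <- p])].

(* The minimum is over all paths of H, which have fewer than #|V| arcs; it is
   None if there is no path. *)
Definition dist (w : edge G -> nat) (H : subnet G) : enat :=
  \big[emin/None]_(p : #|vertex G|.-bseq (edge G) | is_path H p)
    Some (\sum_(a <- p) w a).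

Definition strategy := {ffun edge G -> bool}.

Definition interdict (g : strategy) : subnet G :=
  Subnet [set: vertex G]%SET [set a | ~~ g a]%SET (source G) (sink G).

Variables (l : edge G -> nat * nat) (c : edge G -> nat) (B : nat).

Definition feasible (g : strategy) : bool := \sum_a c a * g a <= B.

Definition objective (g : strategy) : epoint :=
  (dist (fun a => (l a).1) (interdict g), dist (fun a => (l a).2) (interdict g)).

Definition efficient (g : strategy) : Prop :=
  feasible g /\
  forall g' : strategy, feasible g' -> ~~ dominates (objective g') (objective g).

Local Open Scope classical_set_scope.

Definition nondominated_points : set epoint :=
  [set objective g | g in [set g | efficient g]].

(* Only the values at x <= B are meaningful. *)
Fixpoint labels (H : subnet G) (T : decomp_tree H) (x : nat) : set epoint :=
  match T with
  | Leaf a _ =>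
      if (c a <= B) && (c a <= x) then [set (None, None)]
      else [set (Some (l a).1, Some (l a).2)]
  | Par _ _ _ _ T1 T2 =>
      pareto_max (\bigcup_(k in `I_x.+1) odot (labels T1 k) (labels T2 (x - k)))
  | Ser _ _ _ _ T1 T2 =>
      pareto_max (\bigcup_(k in `I_x.+1) oplus (labels T1 k) (labels T2 (x - k)))
  end.

End Interdiction.

(* Main.v *)
From mathcomp Require Import all_boot.
From mathcomp Require Import classical_sets.
(* Defs comes last so that head is the head of an arc, not seq.head. *)
Require Import Defs.

(** For a node H and a strategy g let d(H, g) be the pair of distances in H minus
    the arcs removed by g, and D(H, x) the finite set of all d(H, g) with g of cost
    at most x on the arcs of H. In H the source has no incoming and the sink no
    outgoing arc, so a path of a parallel composition lies on one side and a path
    of a series composition is cut by the middle vertex into two paths. Hence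
    d(H, g) is the minimum, resp. the sum, of d(H1, g) and d(H2, g), and D(H, x) is
    the union over k of D(H1, k) combined with D(H2, x - k). The two operations are
    monotone, and every point of a finite set lies below a maximal one, so replacing
    D(H1, k) and D(H2, x - k) by their maximal points does not change the maximal
    points of the union. Thus L(H, x) is the set of maximal points of D(H, x). *)

Set Implicit Arguments.
Unset Strict Implicit.
Unset Printing Implicit Defensive.

(** * Order, minimum and sum on the extended naturals *)

Lemma ele_refl : reflexive ele.
Proof. by case=> /=. Qed.

Lemma ele_trans : transitive ele.
Proof. by case=> [y|] [x|] [z|] //=; apply: leq_trans. Qed.

Lemma ele_anti x y : ele x y -> ele y x -> x = y.
Proof.
case: x y => [x|] [y|] //= le_xy le_yx.
by congr Some; apply/eqP; rewrite eqn_leq le_xy.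
Qed.

Lemma ele_min z x y : ele z (emin x y) = ele z x && ele z y.
Proof.
by case: x y z => [x|] [y|] [z|] //=; rewrite ?andbT // leq_min.
Qed.

Lemma ele_minl x y : ele (emin x y) x.
Proof. by have := ele_refl (emin x y); rewrite ele_min => /andP[]. Qed.

Lemma ele_minr x y : ele (emin x y) y.
Proof. by have := ele_refl (emin x y); rewrite ele_min => /andP[]. Qed.

Lemma ele_emin2 x x' y y' : ele x x' -> ele y y' -> ele (emin x y) (emin x' y').
Proof.
move=> le_x le_y; rewrite ele_min.
by rewrite (ele_trans (ele_minl _ _) le_x) (ele_trans (ele_minr _ _) le_y).
Qed.

Lemma ele_eadd2 x x' y y' : ele x x' -> ele y y' -> ele (eadd x y) (eadd x' y').
Proof. by case: x x' y y' => [x|] [x'|] [y|] [y'|] //=; apply: leq_add. Qed.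

(** * The Pareto order and sets with the same maximal points *)

Section ParetoOrder.

Local Open Scope classical_set_scope.

Definition eple (y z : epoint) : bool := ele y.1 z.1 && ele y.2 z.2.

Lemma eple_refl : reflexive eple.
Proof. by move=> y; rewrite /eple !ele_refl. Qed.

Lemma eple_trans : transitive eple.
Proof.
move=> y x z /andP[xy1 xy2] /andP[yz1 yz2].
by rewrite /eple (ele_trans xy1) ?(ele_trans xy2).
Qed.

Lemma eple_anti y z : eple y z -> eple z y -> y = z.
Proof.
case: y z => [y1 y2] [z1 z2] /andP[/= le1 le2] /andP[/= ge1 ge2].
by rewrite (ele_anti le1) // (ele_anti le2).
Qed.

Lemma dominatesE y z : dominates y z = eple z y && (y != z).
Proof. by rewrite /dominates /eple andbA. Qed.

(** The relation carried through the induction: it preserves maximal points, and unlike equality of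
    maximal points it passes directly through monotone operations and unions. *)
Definition cofinal (S S' : set epoint) : Prop :=
  S' `<=` S /\ forall y, S y -> exists2 y', S' y' & eple y y'.

(** A maximal point of [S] lies below a point of [S'] and so equals it. A point of [S] dominating a
    maximal point of [S'] would lie below a point of [S'] that dominates it as well. *)
Lemma pareto_max_cofinal S S' : cofinal S S' -> pareto_max S' = pareto_max S.
Proof.
case=> subS cofS; apply/seteqP; split=> y [Sy maxy]; split.
- exact: subS.
- move=> z Sz; apply/negP; rewrite dominatesE => /andP[le_yz ne_zy].
  have [z' S'z' le_zz'] := cofS z Sz.
  have := maxy z' S'z'; rewrite dominatesE (eple_trans le_yz) //= negbK => /eqP def_z'.
  by case/eqP: ne_zy; apply: eple_anti => //; rewrite -def_z'.
- have [z S'z le_yz] := cofS y Sy.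
  have := maxy z (subS _ S'z); rewrite dominatesE le_yz /= negbK => /eqP def_z.
  by rewrite -def_z.
- by move=> z /subS; apply: maxy.
Qed.

Lemma pareto_max1 (S : set epoint) y :
  S y -> (forall z, S z -> eple z y) -> pareto_max S = [set y].
Proof.
move=> Sy max_y; rewrite -(@pareto_max_cofinal S [set y]).
  apply/seteqP; split=> [z []//|_ ->]; split=> // _ ->.
  by rewrite dominatesE eqxx andbF.
by split=> [_ -> //|z /max_y]; exists y.
Qed.

Lemma cofinal_pareto_max (I : finType) (P : pred I) (f : I -> epoint) :
  cofinal [set f i | i in [set i | P i]] (pareto_max [set f i | i in [set i | P i]]).
Proof.
split=> [y []//|_ [i0 Pi0 <-]].
pose up i := [set j | P j & eple (f i) (f j)]%SET.
pose above i := P i && eple (f i0) (f i).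
have above_i0 : above i0 by rewrite /above Pi0 eple_refl.
(* A point above f i0 with as few points above it as possible is maximal. *)
case: (arg_minnP (fun i => #|up i|) above_i0) => i /andP[Pi le_i] min_i.
exists (f i) => //; split; first by exists i.
move=> _ [j Pj <-]; apply/negP; rewrite dominatesE => /andP[le_ij ne_ji].
have := min_i j; rewrite /above Pj (eple_trans le_i) // => /(_ isT).
(* [up j] is strictly smaller than [up i]: it misses [i], by antisymmetry. *)
rewrite leqNgt => /negP; apply; apply/proper_card/properP; split.
  apply/fintype.subsetP=> k; rewrite !inE => /andP[-> le_jk] /=; exact: eple_trans le_jk.
exists i; rewrite !inE Pi ?eple_refl //=.
by apply: contra ne_ji => le_ji; apply/eqP/eple_anti.
Qed.

(** [odot] and [oplus] are by conversion the set images of [emin2] and [eadd2], so one argument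
    about a monotone [op] serves both compositions. *)
Definition emin2 (a b : epoint) : epoint := (emin a.1 b.1, emin a.2 b.2).
Definition eadd2 (a b : epoint) : epoint := (eadd a.1 b.1, eadd a.2 b.2).

Definition monotone_op (op : epoint -> epoint -> epoint) : Prop :=
  forall a a' b b', eple a a' -> eple b b' -> eple (op a b) (op a' b').

Lemma emin2_monotone : monotone_op emin2.
Proof.
by move=> a a' b b' /andP[??] /andP[??]; apply/andP; split; apply: ele_emin2.
Qed.

Lemma eadd2_monotone : monotone_op eadd2.
Proof.
by move=> a a' b b' /andP[??] /andP[??]; apply/andP; split; apply: ele_eadd2.
Qed.

Lemma cofinal_bigcup_op op (I : Type) (J : set I) (S S' T T' : I -> set epoint) :
    monotone_op op ->
    (forall i, J i -> cofinal (S i) (S' i)) ->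
    (forall i, J i -> cofinal (T i) (T' i)) ->
  cofinal (\bigcup_(i in J) [set op a b | a in S i & b in T i])
          (\bigcup_(i in J) [set op a b | a in S' i & b in T' i]).
Proof.
move=> mono_op cofS cofT; split.
  move=> _ [i Ji [a Sa [b Tb <-]]]; exists i => //.
  by exists a; [apply: (cofS i Ji).1 | exists b; first apply: (cofT i Ji).1].
move=> _ [i Ji [a Sa [b Tb <-]]].
have [a' Sa' le_a] := (cofS i Ji).2 a Sa.
have [b' Tb' le_b] := (cofT i Ji).2 b Tb.
exists (op a' b'); last exact: mono_op.
by exists i => //; exists a' => //; exists b'.
Qed.

End ParetoOrder.

(** * Walks, paths and distances *)

Section Walks.

Variable G : network.
Implicit Types (H : subnet G) (p : seq (edge G)) (w : edge G -> nat).

Lemma walk_cat x y z p q : walk x p y -> walk y q z -> walk x (p ++ q) z.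
Proof. by elim: p x => [|a p IHp] x /= => [/eqP-> | /andP[-> /IHp]]. Qed.

Lemma size_path H p : is_path H p -> size p <= #|vertex G|.
Proof.
case/and3P=> _ _ /card_uniqP uniq_p; apply: ltnW.
by have := max_card [in src H :: [seq head a | a <- p]]; rewrite uniq_p /= size_map.
Qed.

(** The universal property of the minimum. It hides the length bound in [dist], which loses no path
    because paths repeat no vertex. *)
Lemma ele_dist z w H :
  ele z (dist w H) <-> forall p, is_path H p -> ele z (Some (\sum_(a <- p) w a)).
Proof.
split=> [le_z p path_p | le_z].
  apply: ele_trans le_z _.
  have size_p := size_path path_p; rewrite /dist.
  have : Bseq size_p \in index_enum _ by rewrite mem_index_enum.
  elim: index_enum => //= q s IHs; rewrite inE big_cons => /predU1P[<- | /IHs le_s].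
    by rewrite path_p ele_minl.
  by case: ifP => // _; apply: ele_trans (ele_minr _ _) le_s.
rewrite /dist; elim/big_ind: _ => [|x y le_x le_y|p path_p]; last exact: le_z.
  by case: (z).
by rewrite ele_min le_x.
Qed.

Lemma dist_le w H p : is_path H p -> ele (dist w H) (Some (\sum_(a <- p) w a)).
Proof. exact: (ele_dist _ _ _).1 (ele_refl _) p. Qed.

Lemma dist_attained w H n :
  dist w H = Some n -> exists2 p, is_path H p & \sum_(a <- p) w a = n.
Proof.
rewrite /dist; elim/big_ind: _ n => // [x y IHx IHy n|p path_p n [<-]]; last by exists p.
case: x y IHx IHy => [x|] [y|] IHx IHy //= [<-]; try by [apply: IHx | apply: IHy].
by rewrite /minn; case: ifP => _; [apply: IHx | apply: IHy].
Qed.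

(** * Invariants of the nodes of a decomposition tree *)

Record well_formed H : Prop := WellFormed {
  wf_src : src H \in vset H;
  wf_snk : snk H \in vset H;
  wf_neq : src H != snk H;
  wf_tail : forall a, a \in eset H -> tail a \in vset H;
  wf_head : forall a, a \in eset H -> head a \in vset H;
  wf_noin : forall a, a \in eset H -> head a != src H;
  wf_noout : forall a, a \in eset H -> tail a != snk H }.

Lemma wf_arc (a : edge G) : tail a != head a -> well_formed (arc_subnet a).
Proof.
move=> ne_a; split=> //=; rewrite ?inE ?eqxx ?orbT // => b /set1P->;
  by rewrite ?inE ?eqxx ?orbT // eq_sym.
Qed.

Lemma par_symm H H1 H2 : is_parallel H H1 H2 -> is_parallel H H2 H1.
Proof.
case=> e_s e_t e_I e_D e_V e_E e_sH e_tH; split=> //.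
- by rewrite finset.setIC e_I e_s e_t.
- by rewrite disjoint_sym.
- by rewrite finset.setUC.
- by rewrite finset.setUC.
- by rewrite e_sH.
- by rewrite e_tH.
Qed.

Lemma wf_par H H1 H2 :
  is_parallel H H1 H2 -> well_formed H1 -> well_formed H2 -> well_formed H.
Proof.
case=> e_s e_t _ _ e_V e_E e_sH e_tH [s1 t1 ne1 tl1 hd1 in1 out1] [s2 t2 ne2 tl2 hd2 in2 out2].
split; rewrite ?e_sH ?e_tH // ?e_V ?e_E ?inE ?s1 ?t1 // => a; rewrite !inE.
- by case/orP=> [/tl1|/tl2]->; rewrite ?orbT.
- by case/orP=> [/hd1|/hd2]->; rewrite ?orbT.
- by case/orP=> [/in1|/in2]; rewrite ?e_s.
- by case/orP=> [/out1|/out2]; rewrite ?e_t.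
Qed.

Lemma ser_mid H H1 H2 x : is_series H H1 H2 -> x \in vset H1 -> x \in vset H2 ->
  x = snk H1.
Proof. by case=> _ e_I *; apply/set1P; rewrite -e_I inE; apply/andP. Qed.

Lemma wf_ser H H1 H2 :
  is_series H H1 H2 -> well_formed H1 -> well_formed H2 -> well_formed H.
Proof.
move=> ser [s1 t1 ne1 tl1 hd1 in1 out1] [s2 t2 ne2 tl2 hd2 in2 out2].
have mid x := @ser_mid _ _ _ x ser.
case: ser => e_m _ _ e_V e_E e_sH e_tH.
split; rewrite ?e_sH ?e_tH // ?e_V ?e_E ?inE ?s1 ?t2 ?orbT //.
(* If the outer terminals coincided, they would be a shared vertex, hence the middle one. *)
- by apply: contraNneq ne1 => e_st; rewrite [src H1]mid // e_st.
- by move=> a; rewrite !inE; case/orP=> [/tl1|/tl2]->; rewrite ?orbT.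
- by move=> a; rewrite !inE; case/orP=> [/hd1|/hd2]->; rewrite ?orbT.
(* An arc of [H2] entering the source of [H1] would enter a shared vertex, which is the source of
   [H2]. The last case is dual. *)
- move=> a; rewrite !inE => /orP[/in1//|Ea].
  apply: contraNneq (in2 a Ea) => e_a.
  by rewrite -e_m [head a]mid ?hd2 // e_a.
- move=> a; rewrite !inE => /orP[Ea|/out2//].
  apply: contraNneq (out1 a Ea) => e_a.
  by rewrite [tail a]mid ?tl1 // e_a.
Qed.

(** All vertices are kept, so that series and parallel compositions survive the removal of arcs. *)
Definition restrict H (g : strategy G) : subnet G :=
  Subnet (vset H) (eset H :&: [set a | ~~ g a]) (src H) (snk H).

Lemma wf_restrict H g : well_formed H -> well_formed (restrict H g).
Proof.
by case=> s t ne tl hd i o; split=> //= a /setIP[Ea _]; auto.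
Qed.

Lemma par_restrict H H1 H2 g :
  is_parallel H H1 H2 -> is_parallel (restrict H g) (restrict H1 g) (restrict H2 g).
Proof.
case=> e_s e_t e_I e_D e_V e_E e_sH e_tH; split=> //=; last by rewrite e_E finset.setIUl.
by apply: disjointW e_D; apply/fintype.subsetP=> a /setIP[].
Qed.

Lemma ser_restrict H H1 H2 g :
  is_series H H1 H2 -> is_series (restrict H g) (restrict H1 g) (restrict H2 g).
Proof.
case=> e_m e_I e_D e_V e_E e_sH e_tH; split=> //=; last by rewrite e_E finset.setIUl.
by apply: disjointW e_D; apply/fintype.subsetP=> a /setIP[].
Qed.

(** * Paths of parallel and series compositions *)

(** Sides can change only at a terminal, but the source is never entered again and the sink is never
    left. *)
Lemma par_walk H H1 H2 x p y : is_parallel H H1 H2 -> well_formed H1 -> well_formed H2 ->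
    x \in vset H1 -> x != src H -> all [in eset H] p -> walk x p y ->
  all [in eset H1] p.
Proof.
move=> par wf1 wf2; have [e_s e_t e_I _ _ e_E e_sH e_tH] := par.
elim: p x => //= a p IHp x V1x ne_xs /andP[Ea Ep] /andP[/eqP e_x w_p].
have E1a: a \in eset H1.
  move: Ea; rewrite e_E inE => /orP[//|E2a].
  have: x \in vset H1 :&: vset H2 by rewrite inE V1x -e_x wf_tail.
  rewrite e_I !inE -e_sH (negPf ne_xs) e_t -e_x.
  by rewrite (negPf (wf_noout wf2 E2a)).
by rewrite E1a (IHp (head a)) ?(wf_head wf1) // e_sH (wf_noin wf1).
Qed.

Lemma par_path_side H H1 H2 a p : is_parallel H H1 H2 -> well_formed H1 -> well_formed H2 ->
  a \in eset H1 -> is_path H (a :: p) -> is_path H1 (a :: p).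
Proof.
move=> par wf1 wf2 E1a /and3P[/=/andP[_ Ep] /andP[/eqP e_a w_p] u_p].
rewrite /is_path /= -(par_source par) -(par_sink par) E1a e_a eqxx w_p u_p !andbT /=.
apply: (par_walk par wf1 wf2 (wf_head wf1 E1a) _ Ep w_p).
by rewrite (par_source par) (wf_noin wf1).
Qed.

Lemma par_path H H1 H2 p : is_parallel H H1 H2 -> well_formed H1 -> well_formed H2 ->
  is_path H p = is_path H1 p || is_path H2 p.
Proof.
move=> par wf1 wf2; have [e_s e_t _ _ _ e_E e_sH e_tH] := par.
apply/idP/orP=> [|[] /and3P[E w u]]; last 2 first.
- rewrite /is_path e_sH e_tH w u !andbT; apply: sub_all E => a /= E1a.
  by rewrite e_E inE E1a.
- rewrite /is_path e_sH e_tH e_s e_t w u !andbT; apply: sub_all E => a /= E2a.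
  by rewrite e_E inE E2a orbT.
(* The empty path is impossible because the terminals differ; otherwise the first arc decides the
   side. *)
case: p => [|a p] path_p.
  case/and3P: path_p => _ /= e_st.
  by rewrite e_sH e_tH (negPf (wf_neq wf1)) in e_st.
have: a \in eset H by case/and3P: path_p => /andP[].
rewrite e_E inE => /orP[Ea|Ea]; [left | right].
  exact: par_path_side par wf1 wf2 Ea path_p.
exact: par_path_side (par_symm par) wf2 wf1 Ea path_p.
Qed.

(** Returning to [H1] would take an arc of [H1] out of the middle vertex, which is its sink. *)
Lemma ser_walk2 H H1 H2 x p y : is_series H H1 H2 -> well_formed H1 -> well_formed H2 ->
    x \in vset H2 -> all [in eset H] p -> walk x p y -> all [in eset H2] p.
Proof.
move=> ser wf1 wf2; elim: p x => //= a p IHp x V2x /andP[Ea Ep] /andP[/eqP e_x w_p].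
have E2a: a \in eset H2.
  move: Ea; rewrite (ser_eset ser) inE => /orP[E1a|//].
  have := wf_noout wf1 E1a; rewrite -(@ser_mid _ _ _ x ser) ?e_x ?eqxx //.
  by rewrite -e_x wf_tail.
by rewrite E2a (IHp (head a)) ?(wf_head wf2).
Qed.

(** The cut is made at the first visit to the middle vertex; until then every arc belongs to
    [H1]. *)
Lemma ser_walk H H1 H2 x p : is_series H H1 H2 -> well_formed H1 -> well_formed H2 ->
    x \in vset H1 -> all [in eset H] p -> walk x p (snk H) ->
  exists p1 p2, [/\ p = p1 ++ p2, all [in eset H1] p1, walk x p1 (snk H1),
    all [in eset H2] p2 & walk (snk H1) p2 (snk H)].
Proof.
move=> ser wf1 wf2; have [e_m e_I _ _ e_E e_sH e_tH] := ser.
elim: p x => [|a p IHp] x V1x.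
  move=> _ /= /eqP e_x; exists [::], [::]; split=> //=.
    by apply/eqP/(ser_mid ser); rewrite // e_x e_tH wf_snk.
  rewrite -e_x eq_sym; apply/eqP/(ser_mid ser); rewrite // e_x e_tH.
  exact: wf_snk.
move=> Ep w_p; have [e_x|ne_x] := eqVneq x (snk H1).
  exists [::], (a :: p); split; rewrite // -?e_x //=.
  by apply: (ser_walk2 ser wf1 wf2 _ Ep w_p); rewrite e_x e_m wf_src.
case/andP: Ep w_p => /= Ea Ep /andP[/eqP e_x w_p].
have E1a: a \in eset H1.
  move: Ea; rewrite e_E inE => /orP[//|/(wf_tail wf2)]; rewrite e_x => V2x.
  by case/eqP: ne_x; apply: ser_mid ser _ _.
have [p1 [p2 [-> E1 w1 E2 w2]]] := IHp _ (wf_head wf1 E1a) Ep w_p.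
by exists (a :: p1), p2; split; rewrite //= ?E1a ?e_x ?eqxx.
Qed.

Lemma walk_last x p y : walk x p y -> last x (map (@head G) p) = y.
Proof. by elim: p x => [|a p IHp] x /= => [/eqP | /andP[_ /IHp]]. Qed.

Lemma ser_path H H1 H2 p : is_series H H1 H2 -> well_formed H1 -> well_formed H2 ->
  is_path H p <-> exists p1 p2, [/\ p = p1 ++ p2, is_path H1 p1 & is_path H2 p2].
Proof.
move=> ser wf1 wf2; have [e_m e_I _ _ e_E e_sH e_tH] := ser.
split=> [/and3P[Ep w_p u_p] | [p1 [p2 [-> /and3P[E1 w1 u1] /and3P[E2 w2 u2]]]]].
  have V1s: src H \in vset H1 by rewrite e_sH wf_src.
  have [p1 [p2 [def_p E1 w1 E2 w2]]] := ser_walk ser wf1 wf2 V1s Ep w_p.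
  exists p1, p2; split=> //.
    rewrite /is_path E1 -e_sH w1 /=.
    by move: u_p; rewrite def_p map_cat -cat_cons cat_uniq => /and3P[].
  rewrite /is_path E2 -e_m -e_tH w2 /=.
  (* The middle vertex, last in the list of the first piece, is moved to the front of the second. *)
  move: u_p; rewrite def_p map_cat -cat_cons lastI cat_rcons cat_uniq.
  by rewrite (walk_last w1) => /and3P[].
apply/and3P; split.
- rewrite all_cat e_E; apply/andP; split; [apply: sub_all E1|apply: sub_all E2] => a /=;
    by rewrite inE => ->; rewrite ?orbT.
- by rewrite e_sH e_tH; apply: walk_cat w1 _; rewrite e_m.
move: u2; rewrite cons_uniq map_cat -cat_cons cat_uniq e_sH u1 /= => /andP[_ ->].
rewrite andbT.
(* A vertex of the first piece entered again by the second would be the middle one, which no arc of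
   [H2] enters. *)
apply/hasPn=> _ /mapP[a p2a ->]; have E2a := allP E2 a p2a.
apply: contra (wf_noin wf2 E2a) => p1a; rewrite -e_m; apply/eqP/(ser_mid ser).
  move: p1a; rewrite inE => /predU1P[->|/mapP[b p1b ->]]; first exact: wf_src.
  by rewrite (wf_head wf1) // (allP E1).
exact: wf_head.
Qed.

(** * Distances in compositions and single arcs *)

Lemma dist_par w H H1 H2 : is_parallel H H1 H2 -> well_formed H1 -> well_formed H2 ->
  dist w H = emin (dist w H1) (dist w H2).
Proof.
move=> par wf1 wf2.
have path_H p := par_path p par wf1 wf2.
apply: ele_anti.
  by rewrite ele_min; apply/andP; split; apply/ele_dist=> p path_p;
    apply: dist_le; rewrite path_H path_p ?orbT.
apply/ele_dist=> p; rewrite path_H => /orP[] /(dist_le w).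
  exact: ele_trans (ele_minl _ _).
exact: ele_trans (ele_minr _ _).
Qed.

(** Cutting paths bounds the distance from below. Concatenating two shortest paths bounds it from
    above, where infinite distances are set apart because no path attains them. *)
Lemma dist_ser w H H1 H2 : is_series H H1 H2 -> well_formed H1 -> well_formed H2 ->
  dist w H = eadd (dist w H1) (dist w H2).
Proof.
move=> ser wf1 wf2; have path_H p := ser_path p ser wf1 wf2.
apply: ele_anti; last first.
  apply/ele_dist=> _ /path_H[p1 [p2 [-> path1 path2]]].
  by rewrite big_cat; apply: (ele_eadd2 (dist_le w path1) (dist_le w path2)).
case def1: (dist w H1) => [n1|] /=; last by case: (dist w H).
case def2: (dist w H2) => [n2|] /=; last by case: (dist w H).
have [p1 path1 <-] := dist_attained def1; have [p2 path2 <-] := dist_attained def2.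
by rewrite -big_cat; apply: dist_le; apply/path_H; exists p1, p2.
Qed.

Lemma arc_path (a : edge G) (g : strategy G) p : tail a != head a ->
  is_path (restrict (arc_subnet a) g) p = ~~ g a && (p == [:: a]).
Proof.
move=> ne_a; apply/idP/andP=> [|[ga /eqP->]]; last first.
  by rewrite /is_path /= !inE !eqxx ga /= ne_a.
case/and3P; case: p => [|b p] /=; first by rewrite (negPf ne_a).
rewrite !inE => /andP[/andP[/eqP-> ga]].
case: p => [|d p] //=.
by rewrite !inE eqxx /= => /andP[/andP[/eqP-> _] _]; rewrite (negPf ne_a).
Qed.

Lemma dist_arc w (a : edge G) (g : strategy G) : tail a != head a ->
  dist w (restrict (arc_subnet a) g) = if g a then None else Some (w a).
Proof.
move=> ne_a; have path_a p := arc_path g p ne_a; apply: ele_anti.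
  case: ifP => ga; first by case: (dist _ _).
  by have := @dist_le w (restrict (arc_subnet a) g) [:: a];
    rewrite big_seq1 path_a ga eqxx; apply.
apply/ele_dist=> p; rewrite path_a => /andP[/negPf-> /eqP->].
by rewrite big_seq1 ele_refl.
Qed.

Lemma restrict_whole (g : strategy G) : restrict (whole G) g = interdict g.
Proof. by rewrite /restrict /= finset.setTI. Qed.

Lemma wf_decomp H : decomp_tree H -> well_formed H.
Proof.
elim=> [a /wf_arc//|H0 H1 H2 par _ wf1 _ wf2|H0 H1 H2 ser _ wf1 _ wf2].
  exact: wf_par par wf1 wf2.
exact: wf_ser ser wf1 wf2.
Qed.

End Walks.

(** * Attainable points and the label recursion *)

Section Labels.

Variables (G : network) (l : edge G -> nat * nat) (c : edge G -> nat) (B : nat).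
Implicit Types (H : subnet G) (g : strategy G).

Local Open Scope classical_set_scope.

Definition cost H g : nat := \sum_(a in eset H) c a * g a.

(** The pair d(H, g); [g] is a strategy on the whole network of which only the values on arcs of [H]
    matter. *)
Definition point H g : epoint :=
  (dist (fun a => (l a).1) (restrict H g), dist (fun a => (l a).2) (restrict H g)).

Definition attainable H x : set epoint := [set point H g | g in [set g | cost H g <= x]].

Lemma eq_cost H g g' : {in eset H, g =1 g'} -> cost H g = cost H g'.
Proof. by move=> eq_g; apply: eq_bigr => a /eq_g->. Qed.

Lemma eq_point H g g' : {in eset H, g =1 g'} -> point H g = point H g'.
Proof.
move=> eq_g; rewrite /point; suff -> : restrict H g = restrict H g' by [].
congr Subnet; apply/setP=> a; rewrite !inE.
by case: (boolP (a \in eset H)) => //= /eq_g->.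
Qed.

Lemma attainable_union op H H1 H2 x :
    eset H = (eset H1 :|: eset H2)%SET -> [disjoint eset H1 & eset H2]%B ->
    (forall g, point H g = op (point H1 g) (point H2 g)) ->
  attainable H x = \bigcup_(k in `I_x.+1)
    [set op a b | a in attainable H1 k & b in attainable H2 (x - k)].
Proof.
move=> e_E dis12 e_op.
have e_cost g : cost H g = cost H1 g + cost H2 g.
  by rewrite /cost -bigU //; apply: eq_bigl => a; rewrite e_E !inE.
apply/seteqP; split=> [_ [g /= le_g <-]|].
  (* The budget is split at the exact cost of [g] on [H1]. *)
  have le_g1 : cost H1 g <= x by apply: leq_trans le_g; rewrite e_cost leq_addr.
  exists (cost H1 g); first by rewrite /= ltnS.
  exists (point H1 g); first by exists g => /=.
  exists (point H2 g); last by rewrite e_op.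
  by exists g => //=; rewrite leq_subRL // -e_cost.
move=> _ [k /= le_k [_ [g1 /= le_g1 <-] [_ [g2 /= le_g2 <-] <-]]].
(* Since the arc sets are disjoint, the two strategies can be glued. *)
pose g : strategy G := [ffun a => if a \in eset H1 then g1 a else g2 a].
have eq1 : {in eset H1, g =1 g1} by move=> a Ea; rewrite ffunE Ea.
have eq2 : {in eset H2, g =1 g2}.
  by move=> a Ea; rewrite ffunE (disjointFl dis12 Ea).
exists g; last by rewrite e_op (eq_point eq1) (eq_point eq2).
rewrite /= e_cost (eq_cost eq1) (eq_cost eq2).
by rewrite -(subnKC (_ : k <= x)) // leq_add.
Qed.

Lemma cofinal_attainable H x : cofinal (attainable H x) (pareto_max (attainable H x)).
Proof. exact: (cofinal_pareto_max (fun g => cost H g <= x)). Qed.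

Lemma pareto_max_attainable op H H1 H2 x :
    monotone_op op ->
    eset H = (eset H1 :|: eset H2)%SET -> [disjoint eset H1 & eset H2]%B ->
    (forall g, point H g = op (point H1 g) (point H2 g)) ->
  pareto_max (\bigcup_(k in `I_x.+1) [set op a b | a in pareto_max (attainable H1 k)
                                       & b in pareto_max (attainable H2 (x - k))])
    = pareto_max (attainable H x).
Proof.
move=> mono e_E dis12 e_op; rewrite (attainable_union x e_E dis12 e_op).
apply/pareto_max_cofinal/cofinal_bigcup_op => // k _; exact: cofinal_attainable.
Qed.

Lemma point_arc (a : edge G) g : tail a != head a ->
  point (arc_subnet a) g = if g a then (None, None) else (Some (l a).1, Some (l a).2).
Proof. by move=> ne_a; rewrite /point !dist_arc //; case: (g a). Qed.

Lemma cost_arc (a : edge G) g : cost (arc_subnet a) g = c a * g a.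
Proof. by rewrite /cost big_set1. Qed.

(** The attainable set has a greatest point: the infinite one if the arc can be afforded, otherwise
    its only point. *)
Lemma pareto_max_arc (a : edge G) x : tail a != head a ->
  pareto_max (attainable (arc_subnet a) x) =
    if c a <= x then [set (None, None)] else [set (Some (l a).1, Some (l a).2)].
Proof.
move=> ne_a; case: ifP => le_x; apply: pareto_max1.
- by exists [ffun=> true]; rewrite ?point_arc //= ?cost_arc ffunE ?muln1.
- by move=> [[?|] [?|]].
- by exists [ffun=> false]; rewrite ?point_arc //= ?cost_arc ffunE ?muln0.
move=> _ [g /= le_g <-]; rewrite point_arc //; case: ifP le_g => [ga|_ _].
  by rewrite cost_arc ga muln1 le_x.
exact: eple_refl.
Qed.

Lemma labels_attainable H (T : decomp_tree H) x : x <= B ->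
  labels l c B T x = pareto_max (attainable H x).
Proof.
elim: T x => {H} [a ne_a|H H1 H2 par T1 IH1 T2 IH2|H H1 H2 ser T1 IH1 T2 IH2] x le_x /=.
(* The test [c a <= B] in [labels] follows from [c a <= x] and [x <= B]. *)
- rewrite pareto_max_arc //; case: (leqP (c a) x) => [le_c|]; last by rewrite andbF.
  by rewrite (leq_trans le_c).
- rewrite -(pareto_max_attainable x emin2_monotone (par_eset par) (par_disjoint par)).
    congr pareto_max; apply: eq_bigcupr => k /= le_k.
    by rewrite IH1 ?IH2 //; [apply: leq_trans le_x; apply: leq_subr | apply: leq_trans le_x].
  move=> g; have wfT H' (T' : decomp_tree H') := wf_restrict g (wf_decomp T').
  by rewrite /point !(dist_par _ (par_restrict g par)) //; apply: wfT.
rewrite -(pareto_max_attainable x eadd2_monotone (ser_eset ser) (ser_disjoint ser)).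
  congr pareto_max; apply: eq_bigcupr => k /= le_k.
  by rewrite IH1 ?IH2 //; [apply: leq_trans le_x; apply: leq_subr | apply: leq_trans le_x].
move=> g; have wfT H' (T' : decomp_tree H') := wf_restrict g (wf_decomp T').
by rewrite /point !(dist_ser _ (ser_restrict g ser)) //; apply: wfT.
Qed.

(** At the root, cost and point become the budget constraint and the objective, so maximal points
    are exactly the values of efficient strategies. *)
Lemma pareto_max_whole :
  pareto_max (attainable (whole G) B) = nondominated_points l c B.
Proof.
have feasE g : (cost (whole G) g <= B) = feasible c B g.
  by congr (_ <= B); apply: eq_bigl => a; rewrite inE.
have pointE g : point (whole G) g = objective l g by rewrite /point restrict_whole.
apply/seteqP; split=> [_ [[g /= feas_g <-] max_g]|_ [g [feas_g max_g] <-]].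
  exists g; rewrite ?pointE //; split=> [|g' feas_g']; first by rewrite -feasE.
  by rewrite -!pointE; apply: max_g; exists g'; rewrite //= feasE.
split=> [|_ [g' /= feas_g' <-]]; first by exists g; rewrite /= ?feasE ?pointE.
by rewrite pointE; apply: max_g; rewrite -feasE.
Qed.

End Labels.

Theorem theorem3 (G : network) (l : edge G -> nat * nat) (c : edge G -> nat)
    (B : nat) (T : decomp_tree (whole G)) :
  labels l c B T B = nondominated_points l c B.
Proof. by rewrite labels_attainable // pareto_max_whole. Qed.
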